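(* Let $z\in(0,1-1/\sqrt2)$. Assume that there is $a>0$ such that for all $\xi>0$ and all (finite measurable) partitions $m$ of $\mathcal X$, $\mathbb P[\mathcal X^2(m)\ge a(|m|+\xi)]\le e^{-\xi}$, and that there is $\delta\ge1$ such that $|m\vee m'|\le\delta(|m|\vee|m'|)$ for all $m,m'\in\mathcal M$. Set $\tau=20az^{-2}$ and let $\{\Delta_m,m\in\mathcal M\}$ satisfy $\Sigma=\sum_{m\in\mathcal M}e^{-\Delta_m}<+\infty$ and $\Delta_m\ge1$ for all $m$. For each $\lambda\in\Lambda$ let $\hat m(\lambda)$ be a partition chosen in $\mathcal M$ on the basis of $N$ (a model selection strategy), and let $\hat s_\lambda=\hat s_{\hat m(\lambda)}$ be the corresponding histogram estimator. Choose $\tilde s=\hat s_{\hat\lambda}$ among $\{\hat s_\lambda,\lambda\in\Lambda\}$ by the selection procedure described in the context with $$\mathrm{pen}(\hat s_\lambda)=z\tau\left(\delta|\hat m(\lambda)|+\Delta_{\hat m(\lambda)}\right)\quad\text{for all }\lambda\in\Lambda.$$ Then, for some constant $C>0$ depending on $z,\delta$ and $\Sigma$ only, $$C\,\mathbb E[H^2(s,\tilde s)]\le\inf_{\lambda\in\Lambda}\mathbb E\left[H^2(s,\hat s_\lambda)+\tau\left(|\hat m(\lambda)|\vee\Delta_{\hat m(\lambda)}\right)\right].$$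
   Context: Setting. $N$ is a random measure on a probability space $(\Omega,\mathcal T,\mathbb P)$ with values in the positive measures on a measured space $(\mathcal X,\mathcal A,\mu)$, with $\mathbb E[N(A)]=\int_As\,d\mu<+\infty$ for all $A\in\mathcal A$, $s\ge0$ measurable. $\mathcal L$ is the set of nonnegative measurable integrable functions on $(\mathcal X,\mathcal A,\mu)$; $\mathcal L_0\subset\mathcal L$ is a known subset containing $s$. $H^2(t,t')=\frac12\int_{\mathcal X}(\sqrt t-\sqrt{t'})^2d\mu$. $\mathcal M$ is an at most countable family of (finite measurable) partitions of $\mathcal X$ and $\Lambda$ is at most countable; $S_m=\{\sum_{I\in m}a_I\mathbf 1_I:(a_I)\in\mathbb R^{|m|}\}\cap\mathcal L_0$ (nonvoid). For partitions $m,m'$: $m\vee m'=\{I\cap I':(I,I')\in m\times m'\}$, $\mathcal X^2(m)=\sum_{I\in m}\left(\sqrt{N(I)}-\sqrt{\mathbb E(N(I))}\right)^2$, $|m|$ is the cardinality of $m$. For $m\in\mathcal M$, $\hat s_m=\sum_{I\in m}\frac{N(I)}{\mu(I)}\mathbf 1_I$ with conventions $0/0=0$, $c/\infty=0$ for $c>0$. Throughout, estimators take values in $\mathcal L_0$, so $\hat s_m\in S_m$. Selection procedure. Let $\rho_r(N,t)=\frac12\left[\int_{\mathcal X}\sqrt{tr}\,d\mu+\int_{\mathcal X}\sqrt{t/r}\,dN\right]$ (conventions $0/0=0$, $a/0=+\infty$ for $a>0$). For $\hat s_\lambda\ne\hat s_{\lambda'}$ put, with $r=(\hat s_\lambda+\hat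 s_{\lambda'})/2$, $$\mathbf T(N,\hat s_\lambda,\hat s_{\lambda'})=\left[\rho_r(N,\hat s_{\lambda'})-\tfrac12\int_{\mathcal X}\hat s_{\lambda'}d\mu-\mathrm{pen}(\hat s_{\lambda'})\right]-\left[\rho_r(N,\hat s_\lambda)-\tfrac12\int_{\mathcal X}\hat s_\lambda d\mu-\mathrm{pen}(\hat s_\lambda)\right].$$ Let $\mathcal E(\hat s_\lambda)$ be the set of those $\hat s_{\lambda'}\ne\hat s_\lambda$ with $\mathbf T(N,\hat s_\lambda,\hat s_{\lambda'})\ge0$, and $\mathcal D(\hat s_\lambda)=\sup\{H^2(\hat s_\lambda,\hat s_{\lambda'}):\hat s_{\lambda'}\in\mathcal E(\hat s_\lambda)\}$ ($=0$ if $\mathcal E(\hat s_\lambda)=\varnothing$). Then $\hat\lambda$ is any element of $\Lambda$ with $\mathcal D(\hat s_{\hat\lambda})\le\mathcal D(\hat s_\lambda)+\tau$ for all $\lambda\in\Lambda$. *)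

(* Defs.v *)
From HB Require Import structures.
From mathcomp Require Import all_boot all_order all_algebra finmap.
From mathcomp Require Import all_classical all_reals all_analysis.
From mathcomp Require Import measurable_realfun.

Set Implicit Arguments.
Unset Strict Implicit.
Unset Printing Implicit Defensive.
Import Order.TTheory GRing.Theory Num.Theory.
Import numFieldNormedType.Exports.

Local Open Scope classical_set_scope.
Local Open Scope ring_scope.
Local Open Scope ereal_scope.

(* As usual, the cells of a partition are nonvoid. *)
Definition finite_measurable_partition {d : measure_display}
    {X : measurableType d} (m : set (set X)) : Prop :=
  [/\ finite_set m, m `<=` measurable & partition m id [set: X]].

Definition psize {X : Type} (m : set (set X)) : nat := #|` fset_set m|%fset.

(* The partition generated by m and m': void intersections are not cells. *)
Definition pjoin {X : Type} (m m' : set (set X)) : set (set X) :=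
  [set J | J !=set0 /\ exists I I', [/\ m I, m' I' & J = I `&` I']].

Section Densities.
Context {d : measure_display} {X : measurableType d} {R : realType}.
Variable mu : {measure set X -> \bar R}.

Definition nonneg_integrable : set (X -> R) :=
  [set t : X -> R | [/\ measurable_fun [set: X] t, forall x, (0 <= t x)%R
             & mu.-integrable [set: X] (EFin \o t)]].

Definition hellinger2 (t t' : X -> R) : \bar R :=
  (2^-1)%:E * \int[mu]_x ((Num.sqrt (t x) - Num.sqrt (t' x)) ^+ 2)%:E.

Definition histogram_model (L0 : set (X -> R)) (m : set (set X)) :
    set (X -> R) :=
  [set t : X -> R | exists a : set X -> R,
     t = (fun x => \sum_(I \in m) a I * \1_I x)%R] `&` L0.

(* In [\bar R], 0 / 0 = 0 * +oo = 0 and c / +oo = c * 0 = 0. When the          *)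
(* intensity of the observed measure has an integrable density with respect to *)
(* mu, nu I / mu I is almost surely finite for each cell I; on the remaining   *)
(* null event [fine] replaces the value +oo by 0.                              *)
Definition histogram (nu : {measure set X -> \bar R}) (m : set (set X)) :
    X -> R :=
  fun x => (\sum_(I \in m) fine (nu I / mu I)%E * \1_I x)%R.

(* In [\bar R], 0 / 0 = 0 and a / 0 = +oo for a > 0, and sqrte +oo = +oo. *)
Definition rho (r : X -> R) (nu : {measure set X -> \bar R}) (t : X -> R) :
    \bar R :=
  (2^-1)%:E * (\int[mu]_x (Num.sqrt (t x * r x))%:E
               + \int[nu]_x sqrte ((t x)%:E / (r x)%:E)).

Section Selection.
Context {L : Type}.
Variables (nu : {measure set X -> \bar R}) (sh : L -> X -> R) (pen : L -> R).

Definition Tstat (l l' : L) : \bar R :=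
  let r x := ((sh l x + sh l' x) / 2)%R in
  let crit k :=
    rho r nu (sh k) - (2^-1)%:E * \int[mu]_x (sh k x)%:E - (pen k)%:E in
  crit l' - crit l.

(* The estimators sh l are referred to by their indices, and the penalty is a  *)
(* function of the index: sh l and sh l' may coincide while pen l <> pen l'.   *)
Definition Eset (l : L) : set L :=
  [set l' | sh l' <> sh l /\ 0 <= Tstat l l'].

Definition Dcrit (l : L) : \bar R :=
  if `[< Eset l = set0 >] then 0
  else ereal_sup [set hellinger2 (sh l) (sh l') | l' in Eset l].

End Selection.
End Densities.

Section RandomMeasure.
Context {dO dX : measure_display} {Omega : measurableType dO}
  {X : measurableType dX} {R : realType}.
Variables (P : probability Omega R) (N : R.-ker Omega ~> X).

Definition has_intensity (mu : {measure set X -> \bar R}) (s : X -> R) : Prop :=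
  forall A, measurable A ->
    \int[P]_w N w A = \int[mu]_(x in A) (s x)%:E /\ \int[P]_w N w A < +oo.

(* The sigma-algebra generated by N, i.e., by the random variables N(A). *)
Definition sigma_of_N : set (set Omega) :=
  <<s [set E | exists2 A, measurable A &
         preimage_set_system [set: Omega] (fun w => N w A) measurable E] >>.

Definition chi2 (m : set (set X)) (w : Omega) : \bar R :=
  \sum_(I \in m) (sqrte (N w I) - sqrte (\int[P]_w' N w' I)) ^+ 2.

End RandomMeasure.

(* Main.v *)
Require Import Defs.
From HB Require Import structures.
From mathcomp Require Import all_boot all_order all_algebra finmap.
From mathcomp Require Import all_classical all_reals all_analysis.
From mathcomp Require Import measurable_realfun ring lra.

(** The test statistic between two histograms [t] and [u] is an estimator of
    [H^2(s, t) - H^2(s, u)], up to penalties. With [r = (t + u) / 2], replacing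
    the observed measure by its intensity in the test leaves an error
    [\int psi * (sqrt s - sqrt r)^2], where
    [psi = (sqrt (u / r) - sqrt (t / r)) / 2] is bounded by
    [kappa = 1 / sqrt 2]; this error is at most
    [kappa * (H^2(s, t) + H^2(s, u))]. The random part is the integral of [psi]
    against the observed measure minus its intensity. As [psi] is constant on
    the cells of the partition generated by those of [t] and [u], it is a sum
    over these cells, and it is bounded by [z * (H^2(s, t) + H^2(s, u))] plus a
    multiple of the chi-square statistic of the common partition. This bound
    does not depend on the values of [t] and [u] on the cells, so the
    histograms may be built from the very same observations. Since
    [kappa + z < 1], a density that wins the test against [t] is not much
    farther from [s] than [t] is (lemmas [drift_le], [deviation_le],
    [score_gap_le], [Tstat_le]).

    The penalties dominate the chi-square statistics of all generated partitions
    up to one random excess. A union bound over pairs of partitions and integer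
    levels shows that this excess is integrable, with expectation at most
    [2 * Sigma ^+ 2] (lemma [chi2_uniform_deviation]).

    Given the excess, everything is deterministic: for any two indices one of
    them wins the test, so the distance of the selected estimator to any other
    one is at most one of the two criteria, both bounded by the risk and
    penalty of the latter (lemmas [selection_risk_le] and
    [pathwise_risk_le]). Integrating over the sample space gives the theorem;
    the contribution [2 * tau * Sigma ^+ 2] of the excess is absorbed because
    the right-hand side is at least [tau]. The integrals are
    lower integrals, and they are subadditive here because the excess is
    measurable (lemma [le_integral_measurableD]). *)

Set Implicit Arguments.
Unset Strict Implicit.
Unset Printing Implicit Defensive.
Import Order.TTheory GRing.Theory Num.Theory.
Import numFieldNormedType.Exports.

Local Open Scope classical_set_scope.
Local Open Scope ring_scope.

(** * Lower integrals and integration of linear inequalities *)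

Section Integrals.
Local Open Scope ereal_scope.
Import HBNNSimple.
Context {d : measure_display} {T : measurableType d} {R : realType}.
Variable mu : {measure set T -> \bar R}.
Implicit Types f g h : T -> R.

Lemma measurable_fun_sqrt f :
  measurable_fun [set: T] f -> measurable_fun [set: T] (fun x => Num.sqrt (f x)).
Proof.
move=> mf; apply: (measurableT_comp _ mf).
by apply: nondecreasing_measurable => // x y; exact: ler_wsqrtr.
Qed.

(** For nonnegative functions the integral is the supremum of the integrals of
    the simple functions below, hence it is monotone even when the functions
    fail to be measurable. *)
Lemma le_nn_integral (f g : T -> \bar R) : (forall x, 0 <= f x) ->
  (forall x, f x <= g x) -> \int[mu]_x f x <= \int[mu]_x g x.
Proof.
move=> f0 fg; rewrite !ge0_integralTE//; last first.
  by move=> x; exact: le_trans (fg x).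
apply: ereal_sup_le => _ [h /= hf <-].
by exists h => //= x; exact: le_trans (fg x).
Qed.

(** The integral of a nonnegative function that may fail to be measurable is a
    lower integral. Lower integrals are not subadditive in general, but they
    are when one of the two terms [h] is measurable: a simple function [p]
    below [f] satisfies [c p <= (c p - h)^+ + h], where [(c p - h)^+] is
    measurable and below [g]. *)
Lemma le_integral_measurableD (c : R) (f g h : T -> \bar R) :
  (0 < c)%R -> (forall x, 0 <= f x) -> (forall x, 0 <= g x) ->
  (forall x, 0 <= h x) -> measurable_fun [set: T] h ->
  (forall x, c%:E * f x <= g x + h x) ->
  c%:E * \int[mu]_x f x <= \int[mu]_x g x + \int[mu]_x h x.
Proof.
move=> c0 f0 g0 h0 mh cfgh.
rewrite [X in _ * X]ge0_integralTE// muleC -lee_pdivlMr//.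
apply: ge_ereal_sup => _ [p /= pf <-].
rewrite lee_pdivlMr// muleC -integralT_nnsfun.
pose q x := maxe (c%:E * (p x)%:E - h x) 0.
have mp : measurable_fun [set: T] (fun x => c%:E * (p x)%:E).
  by apply: emeasurable_funM => //; exact/measurable_EFinP.
have mq : measurable_fun [set: T] q.
  apply: measurable_maxe => //; apply: emeasurable_funB => //.
have p0 x : 0 <= c%:E * (p x)%:E by rewrite mule_ge0// lee_fin// ltW.
have q0 x : 0 <= q x by rewrite /q le_max lexx orbT.
rewrite -ge0_integralZl//=; last 3 first.
  exact/measurable_EFinP.
  by move=> x _; rewrite lee_fin.
  by rewrite lee_fin ltW.
apply: (@le_trans _ _ (\int[mu]_x (q x + h x))).
  apply: ge0_le_integral => //.
    exact: emeasurable_funD.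
  move=> x _; have qNy : q x != -oo by rewrite gt_eqF// (lt_le_trans _ (q0 x)).
  have := h0 x; rewrite /q in qNy *; case: (h x) qNy => [r _|qNy|//] _.
    by rewrite -leeBlDr// le_max lexx.
  by rewrite addey// leey.
rewrite ge0_integralD//; apply: leeD => //; apply: le_nn_integral => // x.
rewrite /q ge_max g0 andbT; have := h0 x; have := cfgh x.
case: (h x) => [r| |//] H _; last by rewrite addeNy leNye.
rewrite leeBlDr//; apply: le_trans H.
by rewrite lee_pmul2l// lte_fin.
Qed.

Lemma dominated_integrable f g : measurable_fun [set: T] f ->
  mu.-integrable [set: T] (EFin \o g) -> (forall x, (`|f x| <= g x)%R) ->
  mu.-integrable [set: T] (EFin \o f).
Proof.
move=> mf ig fg; apply: le_integrable ig => //; first exact/measurable_EFinP.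
move=> x _ /=; rewrite lee_fin; apply: (le_trans (fg x)).
exact: ler_norm.
Qed.

Lemma integral_fine f : mu.-integrable [set: T] (EFin \o f) ->
  \int[mu]_x (f x)%:E = (\int[mu]_x f x)%:E.
Proof. by move=> fi; rewrite /Rintegral fineK//; exact: integrable_fin_num. Qed.

Let Rintegral_cst0 : (\int[mu]_(x in [set: T]) (0 : R) = 0)%R.
Proof. by rewrite /Rintegral integral0. Qed.

(** Integrates a pointwise linear inequality between finitely many integrable
    functions; the list of coefficients and functions is explicit at each use,
    so that [lra] can finish from the result. *)
Lemma Rintegral_lincomb_le0 (l : seq (R * (T -> R))) :
  foldr (fun p P => mu.-integrable [set: T] (EFin \o p.2) /\ P) True l ->
  (forall x, (\sum_(p <- l) p.1 * p.2 x <= 0)%R) ->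
  (\sum_(p <- l) p.1 * \int[mu]_x p.2 x <= 0)%R.
Proof.
move=> il le0.
have [isum <-] : mu.-integrable [set: T]
    (EFin \o (fun x => \sum_(p <- l) p.1 * p.2 x)%R) /\
    (\int[mu]_x (\sum_(p <- l) p.1 * p.2 x) =
     \sum_(p <- l) p.1 * \int[mu]_x p.2 x)%R.
  elim: l il {le0} => [_|[c f] l IH /= [fi /IH[il el]]].
    under eq_Rintegral do rewrite big_nil.
    under eq_fun do rewrite big_nil.
    by rewrite big_nil Rintegral_cst0; split => //; exact: integrable0.
  have cfi : mu.-integrable [set: T] (EFin \o (fun x => c * f x)%R).
    exact: (integrableZl _ c fi).
  under eq_Rintegral do rewrite big_cons.
  under eq_fun do rewrite big_cons.
  rewrite big_cons RintegralD// RintegralZl//= el; split=> //.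
  exact: (integrableD _ cfi il).
rewrite -[leRHS]Rintegral_cst0.
apply: le_Rintegral => //; exact: integrable0.
Qed.

End Integrals.

(** * Pointwise inequalities between square roots *)

Section Pointwise.
Context {R : rcfType}.
Implicit Types s t u n e z : R.

(** The bound on the contrast below, which is where the condition
    [z < 1 - 1 / sqrt 2] comes from. *)
Definition kappa : R := (Num.sqrt 2)^-1.

Lemma kappa_gt0 : 0 < kappa.
Proof. by rewrite invr_gt0 sqrtr_gt0. Qed.

Lemma sqr_kappa : kappa ^+ 2 = 2^-1.
Proof. by rewrite exprVn sqr_sqrtr. Qed.

Lemma kappa_lt1 : kappa < 1.
Proof.
have := kappa_gt0; have := sqr_kappa; move: kappa => k; nra.
Qed.

Lemma le_kappa (x : R) : x ^+ 2 <= 2^-1 -> x <= kappa.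
Proof.
by have := kappa_gt0; have := sqr_kappa; move: kappa => k; nra.
Qed.

(** The function whose integral against the observed measure is the random part
    of the test between the densities [t] and [u]. *)
Definition contrast t u : R :=
  let r := (t + u) / 2 in (Num.sqrt (u / r) - Num.sqrt (t / r)) / 2.

(** The weights [p = sqrt (t / r)] and [q = sqrt (u / r)] satisfy
    [p ^+ 2 + q ^+ 2 = 2], and [p q >= 0]. *)
Lemma contrast_sqr_le t u : 0 <= t -> 0 <= u -> contrast t u ^+ 2 <= 2^-1.
Proof.
move=> t0 u0; rewrite /contrast; set r := (t + u) / 2.
have [r0|r0] := eqVneq r 0.
  by rewrite r0 invr0 !mulr0 sqrtr0 subr0 mul0r expr0n/= invr_ge0.
have rp : 0 < r by rewrite lt_neqAle eq_sym r0 /r divr_ge0// addr_ge0.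
set p := Num.sqrt (t / r); set q := Num.sqrt (u / r).
have p0 : 0 <= p by exact: sqrtr_ge0.
have q0 : 0 <= q by exact: sqrtr_ge0.
have p2 : p ^+ 2 = t / r by rewrite sqr_sqrtr// divr_ge0// ltW.
have q2 : q ^+ 2 = u / r by rewrite sqr_sqrtr// divr_ge0// ltW.
have pq : p ^+ 2 + q ^+ 2 = 2.
  by rewrite p2 q2 -mulrDl; apply: (canLR (mulfK r0)); rewrite /r; lra.
by nra.
Qed.

(** Pointwise form of the drift of the test under [s], increased by the part
    [z / 3 * contrast ^+ 2 * s] that the noise will absorb. With
    [x, y, v, w] the square roots of [s, t, u, r], the drift is exactly
    [(x - y)^2 / 2 - (x - v)^2 / 2 + contrast * (x - w)^2]. As the square root
    is concave, [(x - w)^2] is at most the mean [D] of [(x - y)^2] and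
    [(x - v)^2], and the contrast is at most [kappa]; moreover
    [contrast ^+ 2 * s <= 3 D], by splitting [x = w + (x - w)]. *)
Lemma drift_le z s t u r : 0 < z -> 0 <= s -> 0 <= t -> 0 <= u ->
  r = (t + u) / 2 ->
  Num.sqrt (u * r) / 2 - Num.sqrt (t * r) / 2 + contrast t u * s
    - u / 2 + t / 2 + z / 3 * (contrast t u ^+ 2 * s) <=
  (1 + kappa + z) / 2 * (Num.sqrt s - Num.sqrt t) ^+ 2
    - (1 - kappa - z) / 2 * (Num.sqrt s - Num.sqrt u) ^+ 2.
Proof.
move=> z0 s0 t0 u0 rE.
have c2 := contrast_sqr_le t0 u0.
have r0 : 0 <= r by rewrite rE divr_ge0// addr_ge0.
set x := Num.sqrt s; set y := Num.sqrt t; set v := Num.sqrt u.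
set w := Num.sqrt r.
have sE : s = x ^+ 2 by rewrite sqr_sqrtr.
have tE : t = y ^+ 2 by rewrite sqr_sqrtr.
have uE : u = v ^+ 2 by rewrite sqr_sqrtr.
have wE : w ^+ 2 = (y ^+ 2 + v ^+ 2) / 2 by rewrite sqr_sqrtr// rE -tE -uE.
have [x0 y0 v0 w0] : [/\ 0 <= x, 0 <= y, 0 <= v & 0 <= w].
  by split; exact: sqrtr_ge0.
(* The contrast is [(v - y) / (2 w)], also in the degenerate case [w = 0]. *)
have cE : 2 * (contrast t u * w) = v - y.
  have [r0'|r0'] := eqVneq r 0.
    have [t0' u0'] : t = 0 /\ u = 0 by split; lra.
    by rewrite /w /v /y r0' t0' u0' sqrtr0 !mulr0 subr0.
  have w0' : w != 0 by rewrite sqrtr_eq0 -ltNge lt_neqAle eq_sym r0'.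
  rewrite /contrast -rE !sqrtrM// !sqrtrV// -/y -/v -/w; field.
  exact: w0'.
have ck : contrast t u <= kappa by exact: le_kappa.
move: (contrast t u) c2 cE ck => c c2 cE ck.
rewrite !sqrtrM// -/y -/v -/w.
(* Concavity of the square root. *)
have wyv : (y + v) / 2 <= w by nra.
pose D := ((x - y) ^+ 2 + (x - v) ^+ 2) / 2.
have D0 : 0 <= D by rewrite /D divr_ge0// addr_ge0// sqr_ge0.
have xw : (x - w) ^+ 2 <= D by rewrite /D; nra.
have cxw : c * (x - w) ^+ 2 <= kappa * D.
  apply: (@le_trans _ _ (kappa * (x - w) ^+ 2)).
    by rewrite ler_wpM2r// sqr_ge0.
  by rewrite ler_wpM2l// ltW// kappa_gt0.
have driftE : v * w / 2 - y * w / 2 + c * s - u / 2 + t / 2 =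
    (x - y) ^+ 2 / 2 - (x - v) ^+ 2 / 2 + c * (x - w) ^+ 2.
  rewrite sE uE tE; have -> : v = 2 * (c * w) + y by rewrite cE subrK.
  by field.
(* The three units of [D] are [2] from [c w] and [1]
   from [c (x - w)], where [c ^+ 2 <= 1 / 2]. *)
have vs : c ^+ 2 * s <= 3 * D.
  have h1 : c ^+ 2 * s <= 2 * (c * w) ^+ 2 + 2 * (c ^+ 2 * (x - w) ^+ 2).
    rewrite sE -subr_ge0.
    have -> : 2 * (c * w) ^+ 2 + 2 * (c ^+ 2 * (x - w) ^+ 2) - c ^+ 2 * x ^+ 2 =
      (c * (2 * w - x)) ^+ 2 by ring.
    exact: sqr_ge0.
  have h2 : 2 * (c * w) ^+ 2 <= 2 * D.
    have -> : c * w = (v - y) / 2 by rewrite -cE; field.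
    have := sqr_ge0 ((x - y) + (x - v)); rewrite /D; lra.
  have h3 : c ^+ 2 * (x - w) ^+ 2 <= 2^-1 * D.
    by rewrite ler_pM// ?sqr_ge0.
  lra.
rewrite driftE.
have vz : z / 3 * (c ^+ 2 * s) <= z * D.
  have -> : z * D = z / 3 * (3 * D) by field.
  by rewrite ler_wpM2l// divr_ge0// ltW.
rewrite /D in cxw vz *; lra.
Qed.

(** The noise in one cell, with observed mass [n] and expected mass [e]. Write
    [n - e = (sqrt n - sqrt e)^2 + 2 sqrt e (sqrt n - sqrt e)] and apply the
    arithmetic-geometric inequality to the second term, with weights that leave
    only a small multiple [z / 3] of [c ^+ 2 * e]. *)
Lemma deviation_le z c n e : 0 < z -> c <= kappa -> 0 <= n -> 0 <= e ->
  c * (n - e) <= (kappa + 3 / z) * (Num.sqrt n - Num.sqrt e) ^+ 2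
    + z / 3 * (c ^+ 2 * e).
Proof.
move=> z0 ck n0 e0.
have nE : n = Num.sqrt n ^+ 2 by rewrite sqr_sqrtr.
have eE : e = Num.sqrt e ^+ 2 by rewrite sqr_sqrtr.
rewrite {1}nE {1 3}eE; move: (Num.sqrt n) (Num.sqrt e) => x y.
have h : c * (x - y) ^+ 2 <= kappa * (x - y) ^+ 2 by rewrite ler_wpM2r// sqr_ge0.
have : 0 <= z / 3 * (c * y - 3 / z * (x - y)) ^+ 2.
  by rewrite mulr_ge0 ?sqr_ge0// divr_ge0// ltW.
have -> : z / 3 * (c * y - 3 / z * (x - y)) ^+ 2 =
  z / 3 * (c ^+ 2 * y ^+ 2) + 3 / z * (x - y) ^+ 2 - 2 * c * y * (x - y).
  by field; rewrite gt_eqF.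
by move: h; move: (3 / z) (z / 3) => A B; lra.
Qed.

End Pointwise.

(** * Partitions and cellwise constant functions *)

Section Partitions.
Local Open Scope ereal_scope.
Context {d : measure_display} {X : measurableType d}.
Implicit Types (m : set (set X)) (J : set X).

Lemma pjoin_partition m m' : finite_measurable_partition m ->
  finite_measurable_partition m' -> finite_measurable_partition (pjoin m m').
Proof.
move=> [fm mm [cm tm nm]] [fm' mm' [cm' tm' nm']]; split.
- apply: (@sub_finite_set _ _ [set I `&` I' | I in m & I' in m']).
    by move=> J [_ [I [I' [mI mI' ->]]]]; exists I => //; exists I'.
  exact: finite_image2.
- move=> J [_ [I [I' [mI mI' ->]]]].
  by apply: measurableI; [exact: mm|exact: mm'].
- split; last by move=> J [].
  + apply/seteqP; split=> // x _.
    have [I mI Ix] : cover m id x by rewrite cm.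
    have [I' mI' Ix'] : cover m' id x by rewrite cm'.
    exists (I `&` I') => //; split; first by exists x.
    by exists I, I'.
  + move=> J K [_ [I [I' [mI mI' ->]]]] [_ [L [L' [mL mL' ->]]]].
    move=> [x /= [[Ix Ix'] [Lx Lx']]].
    have -> : I = L by apply: tm => //; exists x.
    by have -> : I' = L' by apply: tm' => //; exists x.
Qed.

(** Constancy on cells is stated without naming the values: [f (get J)] serves
    as the value on the cell [J], which is nonvoid. *)
Definition cellwise_constant {T} m (f : X -> T) :=
  forall J x y, m J -> J x -> J y -> f x = f y.

Lemma cellwise_constantE {T} m (f : X -> T) J x :
  cellwise_constant m f -> m J -> J x -> f x = f (get J).
Proof. by move=> cf mJ Jx; apply: (cf J) => //; apply: getPex; exists x. Qed.

Lemma cellwise_constant_joinl {T} m m' (f : X -> T) :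
  cellwise_constant m f -> cellwise_constant (pjoin m m') f.
Proof.
by move=> cf J x y [_ [I [I' [mI _ ->]]]] [Ix _] [Iy _]; exact: (cf I).
Qed.

Lemma cellwise_constant_joinr {T} m m' (f : X -> T) :
  cellwise_constant m' f -> cellwise_constant (pjoin m m') f.
Proof.
by move=> cf J x y [_ [I [I' [_ mI' ->]]]] [_ Ix] [_ Iy]; exact: (cf I').
Qed.

Context {R : realType}.

Lemma measurable_cellwise m (f : X -> R) : finite_measurable_partition m ->
  cellwise_constant m f -> measurable_fun [set: X] f.
Proof.
move=> [fm mm [cm _ _]] cf _ Y _; rewrite setTI.
have -> : f @^-1` Y = \bigcup_(J in m `&` [set J | Y (f (get J))]) J.
  apply/seteqP; split=> [x /= Yx|x [J [mJ /= YJ] Jx]] /=.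
    have [J mJ Jx] : cover m id x by rewrite cm.
    by exists J => //; split=> //=; rewrite -(cellwise_constantE cf mJ Jx).
  by rewrite (cellwise_constantE cf mJ Jx).
apply: fin_bigcup_measurable => [|J [/mm]//].
exact: finite_setIl.
Qed.

Lemma integral_cellwise (nu : {measure set X -> \bar R}) m (f g : X -> R) :
  finite_measurable_partition m -> cellwise_constant m f ->
  (forall x, (0 <= f x)%R) -> (forall x, (0 <= g x)%R) ->
  measurable_fun [set: X] g ->
  \int[nu]_x (f x * g x)%:E =
  \sum_(J <- fset_set m) (f (get J))%:E * \int[nu]_(x in J) (g x)%:E.
Proof.
move=> fmp cf f0 g0 mg; have mf := measurable_cellwise fmp cf.
case: fmp => fm mm [cm tm _].
pose F J := if J \in m then J else set0.
have FE J : m J -> F J = J by move=> mJ; rewrite /F mem_set.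
have mF J : measurable (F J) by rewrite /F; case: ifPn => [/set_mem/mm|].
have DE : \big[setU/set0]_(J <- fset_set m) F J = [set: X].
  rewrite -bigcup_seq; apply/seteqP; split=> // x _.
  have [J mJ Jx] : cover m id x by rewrite cm.
  by exists J; [rewrite /= in_fset_set// mem_set|rewrite FE].
have mgE : measurable_fun [set: X] (fun x => (g x)%:E) by exact/measurable_EFinP.
rewrite -DE ge0_integral_bigsetU//=; last 3 first.
- move=> J K /=; rewrite !in_fset_set// => /set_mem mJ /set_mem mK.
  by rewrite !FE//; exact: tm.
- by rewrite DE; apply/measurable_EFinP; exact: measurable_funM.
- by move=> x _; rewrite lee_fin mulr_ge0.
rewrite !big_seq; apply: eq_bigr => J; rewrite in_fset_set// => /set_mem mJ.
rewrite FE// -ge0_integralZl_EFin//; last 3 first.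
- exact: mm.
- by move=> x _; rewrite lee_fin.
- exact: measurable_funS mgE.
apply: eq_integral => x /set_mem Jx.
by rewrite EFinM (cellwise_constantE cf mJ Jx).
Qed.

(** [N w J] is measurable in [w] for measurable [J] only, hence the totalization
    [F] of the family of cells. *)
Lemma measurable_chi2 {dO : measure_display} {Omega : measurableType dO}
    (P : probability Omega R) (N : R.-ker Omega ~> X) m :
  finite_measurable_partition m -> measurable_fun [set: Omega] (chi2 P N m).
Proof.
move=> [fm mm _].
pose F J := if J \in m then J else set0.
have mF J : measurable (F J) by rewrite /F; case: ifPn => [/set_mem/mm|].
pose h J w := (er_map Num.sqrt (N w (F J)) - sqrte (\int[P]_w' N w' J)) ^+ 2.
have -> : chi2 P N m = fun w => \sum_(J \in m) h J w.
  apply/funext => w; apply: eq_fsbigr => J mJ.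
  rewrite /h /F mJ; congr ((_ - _) ^+ 2).
  have : 0 <= N w J by exact: measure_ge0.
  by case: (N w J).
apply: (@emeasurable_fsum _ _ _ _ _ m h fm) => J.
have mh : measurable_fun [set: Omega]
    (fun w => er_map Num.sqrt (N w (F J)) - sqrte (\int[P]_w' N w' J)).
  apply: emeasurable_funB => //.
  apply: (measurableT_comp _ (measurable_kernel N _ (mF J))).
  apply: (measurable_er_map Omega).
  by apply: nondecreasing_measurable => // x y; exact: ler_wsqrtr.
rewrite /h; under eq_fun do rewrite expe2.
exact: emeasurable_funM.
Qed.

End Partitions.

(** * The test between two densities *)

Section Criterion.
Local Open Scope ereal_scope.
Context {d : measure_display} {X : measurableType d} {R : realType}.
Variable mu : {measure set X -> \bar R}.
Implicit Types s t u : X -> R.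

(** The value of [hellinger2] as a real number, legitimate between integrable
    densities. *)
Definition Hsq t u : R :=
  (2^-1 * \int[mu]_x (Num.sqrt (t x) - Num.sqrt (u x)) ^+ 2)%R.

Lemma integrable_sqr_sqrtB t u : nonneg_integrable mu t ->
  nonneg_integrable mu u ->
  mu.-integrable [set: X]
    (EFin \o (fun x => (Num.sqrt (t x) - Num.sqrt (u x)) ^+ 2)%R).
Proof.
move=> [mt t0 it] [mv u0 iu].
apply: (@dominated_integrable _ _ _ mu _ (fun x => t x + u x)%R).
- by apply: measurable_funX; apply: measurable_funB; exact: measurable_fun_sqrt.
- exact: (integrableD _ it iu).
- move=> x; rewrite ger0_norm ?sqr_ge0//.
  have := mulr_ge0 (sqrtr_ge0 (t x)) (sqrtr_ge0 (u x)).
  have := sqr_sqrtr (t0 x); have := sqr_sqrtr (u0 x); nra.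
Qed.

Lemma hellinger2_fin t u : nonneg_integrable mu t -> nonneg_integrable mu u ->
  hellinger2 mu t u = (Hsq t u)%:E.
Proof.
by move=> ht hu; rewrite /hellinger2 integral_fine//; exact: integrable_sqr_sqrtB.
Qed.

Lemma Hsq_ge0 t u : (0 <= Hsq t u)%R.
Proof. by rewrite mulr_ge0// Rintegral_ge0// => x _; exact: sqr_ge0. Qed.

Lemma HsqC t u : Hsq t u = Hsq u t.
Proof.
by congr (_ * _)%R; apply: eq_Rintegral => x _; rewrite -sqrrN opprB.
Qed.

Lemma Hsq_triangle s t u : nonneg_integrable mu s ->
  nonneg_integrable mu t -> nonneg_integrable mu u ->
  (Hsq t u <= 2 * (Hsq s t + Hsq s u))%R.
Proof.
move=> hs ht hu.
pose l : seq (R * (X -> R)) :=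
  [:: (1, fun x => (Num.sqrt (t x) - Num.sqrt (u x)) ^+ 2);
      (- 2, fun x => (Num.sqrt (s x) - Num.sqrt (t x)) ^+ 2);
      (- 2, fun x => (Num.sqrt (s x) - Num.sqrt (u x)) ^+ 2)]%R.
have il : foldr (fun p P => mu.-integrable [set: X] (EFin \o p.2) /\ P) True l.
  by do !split => //; exact: integrable_sqr_sqrtB.
have := Rintegral_lincomb_le0 il; rewrite /Hsq /l !big_cons big_nil /= => H.
suff /H : forall x, (\sum_(p <- l) p.1 * p.2 x <= 0)%R by lra.
move=> x; rewrite !big_cons big_nil /=.
have := sqr_ge0 ((Num.sqrt (s x) - Num.sqrt (t x)) +
                 (Num.sqrt (s x) - Num.sqrt (u x)))%R; lra.
Qed.

(** The test between two densities [t] and [u] that are constant on the cells of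
    a common partition [m], for an observed measure [nu] which is finite on
    the cells. *)
Section TwoDensities.
Variables (nu : {measure set X -> \bar R}) (s t u : X -> R) (m : set (set X)).
Hypothesis hs : nonneg_integrable mu s.
Hypothesis ht : nonneg_integrable mu t.
Hypothesis hu : nonneg_integrable mu u.
Hypothesis hm : finite_measurable_partition m.
Hypothesis nufin : forall J, m J -> nu J < +oo.
Hypothesis ct : cellwise_constant m t.
Hypothesis cu : cellwise_constant m u.

Let r x := ((t x + u x) / 2)%R.
Let weight v x := Num.sqrt (v x / r x).
Let count J := fine (nu J).
Let mass J := fine (\int[mu]_(x in J) (s x)%:E).

Let t0 x : (0 <= t x)%R. Proof. by have [_ + _] := ht; exact. Qed.
Let u0 x : (0 <= u x)%R. Proof. by have [_ + _] := hu; exact. Qed.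
Let s0 x : (0 <= s x)%R. Proof. by have [_ + _] := hs; exact. Qed.
Let r0 x : (0 <= r x)%R. Proof. by rewrite divr_ge0// addr_ge0. Qed.

Let countE J : m J -> nu J = (count J)%:E.
Proof.
by move=> mJ; rewrite fineK// ge0_fin_numE// nufin.
Qed.

Let massE J : m J -> \int[mu]_(x in J) (s x)%:E = (mass J)%:E.
Proof.
move=> mJ; have [_ /(_ _ mJ) mJ' _] := hm; have [_ _ is_] := hs.
by rewrite fineK//; apply: integrable_fin_num => //; exact: integrableS is_.
Qed.

Let mass_ge0 J : (0 <= mass J)%R.
Proof. by apply/fine_ge0/integral_ge0 => x _; rewrite lee_fin. Qed.

Let cellwise_pair (F : R -> R -> R) :
  cellwise_constant m (fun x => F (t x) (u x)).
Proof. by move=> J x y mJ Jx Jy; rewrite (ct mJ Jx Jy) (cu mJ Jx Jy). Qed.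

(* The observed measure enters the test only through its values on the cells;
   this and [rho_fin] express both sides as sums over the same cells. *)
Let bounded_weight_integral (F : R -> R -> R) c :
  (forall x, (0 <= F (t x) (u x) <= c)%R) ->
  mu.-integrable [set: X] (EFin \o (fun x => F (t x) (u x) * s x)%R) /\
  (\int[mu]_x (F (t x) (u x) * s x) =
    \sum_(J <- fset_set m) F (t (get J)) (u (get J)) * mass J)%R.
Proof.
move=> F0c; have [ms _ is_] := hs.
have mF := measurable_cellwise hm (cellwise_pair F).
have Fi : mu.-integrable [set: X] (EFin \o (fun x => F (t x) (u x) * s x)%R).
  apply: (@dominated_integrable _ _ _ mu _ (fun x => c * s x)%R).
  - exact: measurable_funM.
  - exact: (integrableZl _ c is_).
  - move=> x; have /andP[F0 Fc] := F0c x.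
    by rewrite ger0_norm ?mulr_ge0// ler_wpM2r.
split=> //; rewrite /Rintegral (@integral_cellwise _ _ _ mu m _ s hm)//.
- have [fm _ _] := hm.
  rewrite [X in fine X](_ : _ = \sum_(J <- fset_set m)
      (F (t (get J)) (u (get J)) * mass J)%:E); first by rewrite sumEFin.
  rewrite !big_seq; apply: eq_bigr => J; rewrite in_fset_set// => /set_mem mJ.
  by rewrite massE.
by move=> x; case/andP: (F0c x).
Qed.

(** [v] is [t] or [u]; the function [F] covers both cases, being one of the two
    projections. *)
Lemma rho_fin (F : R -> R -> R) v :
  (forall x, v x = F (t x) (u x)) -> (forall x, 0 <= v x <= t x + u x)%R ->
  mu.-integrable [set: X] (EFin \o (fun x => Num.sqrt (v x * r x))) /\
  rho mu r nu v = (2^-1 * (\int[mu]_x Num.sqrt (v x * r x)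
    + \sum_(J <- fset_set m) weight v (get J) * count J))%:E.
Proof.
move=> vE v0; have [mt _ it] := ht; have [mv _ iu] := hu.
(* Where [r] vanishes so does [v], and the conventions [0 / 0 = 0] of the two
   divisions agree. *)
have vr x : v x = 0%R \/ (r x != 0)%R.
  have [r0'|] := eqVneq (r x) 0%R; [left|by right].
  by have := v0 x; have := t0 x; have := u0 x; rewrite /r in r0' *; lra.
have mvv : measurable_fun [set: X] v.
  by rewrite (funext vE); exact: measurable_cellwise hm (cellwise_pair F).
have mr : measurable_fun [set: X] r.
  exact: measurable_cellwise hm (cellwise_pair (fun a b => (a + b) / 2)%R).
have isqrt : mu.-integrable [set: X] (EFin \o (fun x => Num.sqrt (v x * r x))).
  apply: (@dominated_integrable _ _ _ mu _ (fun x => t x + u x)%R).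
  - by apply: measurable_fun_sqrt; exact: measurable_funM.
  - exact: (integrableD _ it iu).
  - move=> x; have /andP[v0x vx] := v0 x.
    have w0 := sqrtr_ge0 (v x * r x).
    have := sqr_sqrtr (mulr_ge0 v0x (r0 x)); rewrite ger0_norm//.
    move: (Num.sqrt _) w0 => w w0; have := t0 x; have := u0 x.
    by move: v0x vx; rewrite /r; nra.
split=> //; rewrite /rho integral_fine//.
have -> : \int[nu]_x sqrte ((v x)%:E / (r x)%:E) =
    \int[nu]_x (weight v x * cst 1%R x)%:E.
  apply: eq_integral => x _; rewrite mulr1 /weight.
  have [->|rx] := vr x; first by rewrite mul0r mul0e sqrte0 sqrtr0.
  by rewrite inver (negbTE rx).
rewrite (@integral_cellwise _ _ _ nu m)//.
- have [fm mm _] := hm; rewrite EFinM EFinD; congr (_ * (_ + _)).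
  rewrite -sumEFin !big_seq; apply: eq_bigr => J.
  rewrite in_fset_set// => /set_mem mJ.
  have -> : \int[nu]_(x in J) (cst 1%R x)%:E = \int[nu]_(x in J) cst 1 x by [].
  by rewrite integral_cst ?mul1e ?countE//; exact: mm.
- move=> J x y mJ Jx Jy; rewrite /weight !vE /r.
  by rewrite (ct mJ Jx Jy) (cu mJ Jx Jy).
- by move=> x; exact: sqrtr_ge0.
Qed.

Let chi := (\sum_(J <- fset_set m)
  (Num.sqrt (count J) - Num.sqrt (mass J)) ^+ 2)%R.

Let score v := (2^-1 * (\int[mu]_x Num.sqrt (v x * r x)
    + \sum_(J <- fset_set m) weight v (get J) * count J)
  - 2^-1 * \int[mu]_x v x)%R.

Let weight_le2 v x : (0 <= v x <= t x + u x)%R -> (0 <= weight v x <= 2)%R.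
Proof.
move=> /andP[v0 vtu]; rewrite sqrtr_ge0/= /weight.
have [r0'|rx] := eqVneq (r x) 0%R; first by rewrite r0' invr0 mulr0 sqrtr0.
have vr : (0 <= v x / r x <= 2)%R.
  rewrite divr_ge0//= ler_pdivrMr; first by rewrite /r; lra.
  by rewrite lt_neqAle eq_sym rx r0.
by have /andP[/sqr_sqrtr] := vr; have := sqrtr_ge0 (v x / r x)%R; nra.
Qed.

Let integral_weight v (F : R -> R -> R) :
  (forall x, v x = F (t x) (u x)) -> (forall x, 0 <= v x <= t x + u x)%R ->
  mu.-integrable [set: X] (EFin \o (fun x => weight v x * s x)%R) /\
  (\int[mu]_x (weight v x * s x) =
    \sum_(J <- fset_set m) weight v (get J) * mass J)%R.
Proof.
move=> vE v0.
have wE : weight v = (fun x => Num.sqrt (F (t x) (u x) / ((t x + u x) / 2))).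
  by apply/funext => x; rewrite /weight vE.
have := @bounded_weight_integral
  (fun a b => Num.sqrt (F a b / ((a + b) / 2)))%R 2%R; rewrite wE; apply.
by move=> x; have := weight_le2 (v0 x); rewrite wE.
Qed.

(** The gap of scores is the integral of the drift of [drift_le] plus the noise,
    the integral of the contrast against [nu] minus the intensity. The noise
    costs [(kappa + 3 / z) * chi] and the integral of
    [z / 3 * contrast ^+ 2 * s], which has been included in the drift. *)
Lemma score_gap_le z : (0 < z)%R ->
  (score u - score t <= (1 + kappa + z) * Hsq s t - (1 - kappa - z) * Hsq s u
     + (kappa + 3 / z) * chi)%R.
Proof.
move=> z0; have [mt _ it] := ht; have [_ _ iu] := hu.
have tb x : (0 <= t x <= t x + u x)%R by rewrite t0 lerDl u0.
have ub x : (0 <= u x <= t x + u x)%R by rewrite u0 lerDr t0.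
have [itr _] := @rho_fin (fun a _ => a) t (fun=> erefl) tb.
have [iur _] := @rho_fin (fun _ b => b) u (fun=> erefl) ub.
have [its tsE] := @integral_weight t (fun a _ => a) (fun=> erefl) tb.
have [ius usE] := @integral_weight u (fun _ b => b) (fun=> erefl) ub.
have [ics csE] := @bounded_weight_integral
  (fun a b => contrast a b ^+ 2)%R (2^-1)%R
  (fun x => introT andP (conj (sqr_ge0 _) (contrast_sqr_le (t0 x) (u0 x)))).
have ist := integrable_sqr_sqrtB hs ht.
have isu := integrable_sqr_sqrtB hs hu.
pose l : seq (R * (X -> R)) :=
  [:: (2^-1, fun x => Num.sqrt (u x * r x));
      (- 2^-1, fun x => Num.sqrt (t x * r x));
      (2^-1, fun x => weight u x * s x); (- 2^-1, fun x => weight t x * s x);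
      (- 2^-1, u); (2^-1, t);
      (z / 3, fun x => contrast (t x) (u x) ^+ 2 * s x);
      (- ((1 + kappa + z) / 2),
        fun x => (Num.sqrt (s x) - Num.sqrt (t x)) ^+ 2);
      ((1 - kappa - z) / 2,
        fun x => (Num.sqrt (s x) - Num.sqrt (u x)) ^+ 2)]%R.
have il : foldr (fun p P => mu.-integrable [set: X] (EFin \o p.2) /\ P) True l.
  by do !split.
have drift : (\sum_(p <- l) p.1 * \int[mu]_x p.2 x <= 0)%R.
  apply: (Rintegral_lincomb_le0 il) => x.
  have := @drift_le _ z (s x) (t x) (u x) (r x) z0 (s0 x) (t0 x) (u0 x) erefl.
  rewrite !big_cons big_nil /= /contrast -/(r x) -/(weight t x) -/(weight u x).
  lra.
have noise : (2^-1 * \sum_(J <- fset_set m) weight u (get J) * count J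
    - 2^-1 * \sum_(J <- fset_set m) weight t (get J) * count J
    - 2^-1 * \sum_(J <- fset_set m) weight u (get J) * mass J
    + 2^-1 * \sum_(J <- fset_set m) weight t (get J) * mass J
  <= (kappa + 3 / z) * chi + z / 3 *
     \sum_(J <- fset_set m) contrast (t (get J)) (u (get J)) ^+ 2 * mass J)%R.
  rewrite /chi !mulr_sumr -!sumrB -!big_split/=; apply: ler_sum => J _.
  have c0 : (0 <= count J)%R by exact/fine_ge0/measure_ge0.
  have ck : (contrast (t (get J)) (u (get J)) <= kappa)%R.
    exact/le_kappa/contrast_sqr_le.
  have := deviation_le z0 ck c0 (mass_ge0 J).
  by rewrite {1}/contrast -/(r _) -/(weight t _) -/(weight u _); lra.
move: drift noise; rewrite /l !big_cons big_nil /= tsE usE csE /score /Hsq.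
lra.
Qed.

Let chiE : \sum_(J \in m)
    (sqrte (nu J) - sqrte (\int[mu]_(x in J) (s x)%:E)) ^+ 2 = chi%:E.
Proof.
have [fm _ _] := hm; rewrite fsbig_finite// /chi -sumEFin !big_seq.
apply: eq_bigr => J; rewrite in_fset_set// => /set_mem mJ.
by rewrite countE// massE//= -EFinB -EFin_expe.
Qed.

(** The test is finite and antisymmetric in the two competitors, so that each
    pair is decided in favour of at least one of them; and it can favour [l']
    only if [l'] is about as close to [s] as [l], up to the noise and the
    penalty. *)
Lemma Tstat_le (L : Type) (sh : L -> X -> R) (pen : L -> R) (l l' : L)
    (K z : R) : sh l = t -> sh l' = u -> (0 < z)%R ->
  \sum_(J \in m)
    (sqrte (nu J) - sqrte (\int[mu]_(x in J) (s x)%:E)) ^+ 2 <= K%:E ->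
  exists T : R, [/\ Tstat mu nu sh pen l l' = T%:E,
    Tstat mu nu sh pen l' l = (- T)%:E &
    (T <= (1 + kappa + z) * Hsq s t - (1 - kappa - z) * Hsq s u
      + (kappa + 3 / z) * K + pen l - pen l')%R].
Proof.
move=> lt lu z0; rewrite chiE lee_fin => chiK.
have tb x : (0 <= t x <= t x + u x)%R by rewrite t0 lerDl u0.
have ub x : (0 <= u x <= t x + u x)%R by rewrite u0 lerDr t0.
have [_ rtE] := @rho_fin (fun a _ => a) t (fun=> erefl) tb.
have [_ ruE] := @rho_fin (fun _ b => b) u (fun=> erefl) ub.
have [_ _ it] := ht; have [_ _ iu] := hu.
have rE : (fun x => (sh l x + sh l' x) / 2)%R = r by rewrite lt lu.
have rE' : (fun x => (sh l' x + sh l x) / 2)%R = r.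
  by apply/funext => x; rewrite addrC lt lu.
exists ((score u - pen l') - (score t - pen l))%R; split.
- by rewrite /Tstat rE lt lu rtE ruE !integral_fine.
- by rewrite [(- (_ - _))%R]opprB /Tstat rE' lt lu rtE ruE !integral_fine.
- have := score_gap_le z0.
  have : ((kappa + 3 / z) * chi <= (kappa + 3 / z) * K)%R.
    by rewrite ler_wpM2l// addr_ge0 ?divr_ge0// ltW// kappa_gt0.
  lra.
Qed.

End TwoDensities.
End Criterion.

(** * The selection rule *)

(** Deterministic analysis of the selection rule, for a fixed observation for
    which all tests obey a common bound. *)
Section Selection.
Local Open Scope ereal_scope.
Context {d : measure_display} {X : measurableType d} {R : realType}.
Variables (mu nu : {measure set X -> \bar R}) (L : Type) (sh : L -> X -> R).
Variables (pen : L -> R) (s : X -> R) (b e tau : R).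
Hypothesis hs : nonneg_integrable mu s.
Hypothesis hsh : forall l, nonneg_integrable mu (sh l).
Hypothesis b01 : (0 < b <= 1)%R.
Hypothesis e0 : (0 <= e)%R.
Hypothesis tau0 : (0 <= tau)%R.
Hypothesis pen0 : forall l, (0 <= pen l)%R.
Hypothesis test_le : forall l l', exists T : R,
  [/\ Tstat mu nu sh pen l l' = T%:E, Tstat mu nu sh pen l' l = (- T)%:E &
    (T <= 2 * (Hsq mu s (sh l) + pen l) - b * Hsq mu s (sh l') + e)%R].

Lemma le_Dcrit l l' : Eset mu nu sh pen l l' ->
  (Hsq mu (sh l) (sh l'))%:E <= Dcrit mu nu sh pen l.
Proof.
move=> El; rewrite /Dcrit; case: asboolP => [E0|_].
  by move: El; rewrite E0.
by rewrite -hellinger2_fin//; apply: ereal_sup_ubound; exists l'.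
Qed.

(** A competitor [l'] that the test prefers to [l] has a risk bounded in terms
    of the one of [l], so that it lies in a Hellinger ball around [sh l]. In the radius,
    [6 = 2 * (1 + 2)]: a factor [2] from the triangle inequality for squares,
    then the risk of [l] and twice the same from the test. *)
Lemma Dcrit_le l : Dcrit mu nu sh pen l <=
  (b^-1 * (6 * (Hsq mu s (sh l) + pen l) + 2 * e))%:E.
Proof.
have [b0 b1] := andP b01; have h0 := Hsq_ge0 mu s (sh l).
have p0 := pen0 l.
rewrite /Dcrit; case: asboolP => _.
  by rewrite lee_fin mulr_ge0 ?invr_ge0 ?(ltW b0)//; move: h0 p0 e0; lra.
apply: ge_ereal_sup => _ [l' [_ Tge0] <-].
have [T [TE _ Tle]] := test_le l l'.
rewrite hellinger2_fin// lee_fin ler_pdivlMl//.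
move: Tge0; rewrite TE lee_fin => T0.
have := Hsq_triangle hs (hsh l) (hsh l') => /(ler_wpM2l (ltW b0)).
have : (b * Hsq mu s (sh l) <= Hsq mu s (sh l))%R by rewrite ler_piMl.
move: T0 Tle; nra.
Qed.

(** The selected [lh] is close to every [l]: if the test prefers [l] to [lh]
    then the distance is at most the criterion at [lh], which is nearly minimal,
    and otherwise at most the criterion at [l]. *)
Lemma selection_risk_le lh l :
  Dcrit mu nu sh pen lh <= Dcrit mu nu sh pen l + tau%:E ->
  (Hsq mu s (sh lh) <=
    14 / b * (Hsq mu s (sh l) + pen l + e + tau))%R.
Proof.
move=> Dlh; have [b0 b1] := andP b01; have h0 := Hsq_ge0 mu s (sh l).
have p0 := pen0 l.
rewrite mulrAC ler_pdivlMr//.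
have [->|shne] := pselect (sh lh = sh l).
  have : (Hsq mu s (sh l) * b <= Hsq mu s (sh l))%R by rewrite ler_piMr.
  by move: h0 p0 e0 tau0; lra.
have close : (Hsq mu (sh l) (sh lh) <=
    b^-1 * (6 * (Hsq mu s (sh l) + pen l) + 2 * e) + tau)%R.
  have [T [TE TE' _]] := test_le l lh.
  rewrite -lee_fin EFinD; have [T0|T0] := leP 0%R T.
    apply: (@le_trans _ _ (Dcrit mu nu sh pen l)).
      by apply: le_Dcrit; split => //; rewrite TE lee_fin.
    by rewrite -[leLHS]adde0 leeD// ?Dcrit_le// lee_fin.
  apply: (@le_trans _ _ (Dcrit mu nu sh pen lh)).
    rewrite HsqC; apply: le_Dcrit; split => //; first by move/esym.
    by rewrite TE' lee_fin oppr_ge0 ltW.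
  by apply: (le_trans Dlh); rewrite leeD2r// Dcrit_le.
have := Hsq_triangle (hsh l) hs (hsh lh); rewrite HsqC.
move/(ler_wpM2r (ltW b0)).
move: close => /(ler_wpM2l (ltW b0)); rewrite mulrDr mulVKf ?gt_eqF//.
have : (b * tau <= tau)%R by rewrite ler_piMl.
have : (b * Hsq mu s (sh l) <= Hsq mu s (sh l))%R by rewrite ler_piMl.
move: h0 p0 e0 tau0; rewrite (HsqC mu (sh l) s); lra.
Qed.

End Selection.

(** * Sums over countable families *)

Section Sums.
Local Open Scope ereal_scope.
Context {R : realType}.

Lemma esumZl_le {T : choiceType} (I : set T) (c : R) (a : T -> \bar R) :
  (0 <= c)%R -> (forall i, 0 <= a i) ->
  \esum_(i in I) (c%:E * a i) <= c%:E * \esum_(i in I) a i.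
Proof.
move=> c0 a0; apply: ge_ereal_sup => _ [A [fA AI] <-].
rewrite -ge0_mule_fsumr//; apply: lee_wpmul2l; first by rewrite lee_fin.
by apply: esum_ge; exists A.
Qed.

(** Comparison with the geometric series of ratio [1 / 2], as [2 <= expR 1]. *)
Lemma esum_expRN_nat :
  \esum_(k in [set: nat]) (expR (- k%:R))%:E <= 2%:E :> \bar R.
Proof.
rewrite -nneseries_esumT; last by move=> k; rewrite lee_fin expR_ge0.
apply: lime_le; first by apply: is_cvg_nneseries => k _ _; rewrite lee_fin expR_ge0.
apply: nearW => n; rewrite sumEFin lee_fin.
have expRN_le k : (expR (- k%:R) <= 2^-1 ^+ k :> R)%R.
  rewrite expRN exprVn lef_pV2 ?posrE ?expR_gt0 ?exprn_gt0//.
  rewrite -[k%:R]mulr1 expRM_natl lerXn2r ?nnegrE ?expR_ge0//.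
  by have := @expR_ge1Dx R 1; lra.
suff : (\sum_(0 <= k < n) expR (- k%:R) <= 2 - 2 * 2^-1 ^+ n :> R)%R.
  have : (0 <= 2^-1 ^+ n :> R)%R by rewrite exprn_ge0// invr_ge0.
  lra.
elim: n => [|n IH]; first by rewrite big_geq// expr0; lra.
rewrite big_nat_recr//= exprS; have := expRN_le n; lra.
Qed.

(** Monotone convergence for sums over a countable index set, by transport along
    an injection [e] of the indices into the natural numbers. *)
Lemma integral_esum {T : pointedType} {d : measure_display}
    {Omega : measurableType d} (mu : {measure set Omega -> \bar R})
    (Q : set T) (f : T -> Omega -> \bar R) : countable Q ->
  (forall q, Q q -> measurable_fun [set: Omega] (f q)) ->
  (forall q w, Q q -> 0 <= f q w) ->
  measurable_fun [set: Omega] (fun w => \esum_(q in Q) f q w) /\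
  \int[mu]_w (\esum_(q in Q) f q w) = \esum_(q in Q) (\int[mu]_w f q w).
Proof.
move=> /countable_injP[e einj] mf f0.
pose g := 'pinv_(fun=> point) Q e.
have gK q : Q q -> g (e q) = q.
  by move=> Qq; rewrite /g pinvKV ?inE.
pose F n w := if n \in e @` Q then f (g n) w else 0.
have Qg n : n \in e @` Q -> Q (g n).
  by move=> /set_mem[q Qq <-]; rewrite gK.
have F0 n w : 0 <= F n w by rewrite /F; case: ifPn => // /Qg/f0.
have mF n : measurable_fun [set: Omega] (F n).
  by rewrite /F; case: (boolP (n \in _)) => [/Qg/mf|_]; last exact: measurable_cst.
have esumE (a : T -> \bar R) (b : nat -> \bar R) : (forall q, Q q -> 0 <= a q) ->
    (forall n, b n = if n \in e @` Q then a (g n) else 0) ->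
    \esum_(q in Q) a q = \sum_(n <oo) b n.
  move=> a0 bE; rewrite (eq_eseriesr (fun n _ => bE n)).
  rewrite -eseries_mkcond nneseries_esum; last by move=> n /Qg/a0.
  rewrite set_mem_set esum_image; last by move=> x y /= ? ?; exact: einj.
  by apply: eq_esum => q Qq; rewrite gK.
have fE w : \esum_(q in Q) f q w = \sum_(n <oo) F n w.
  by apply: esumE => // q; exact: f0.
under eq_fun do rewrite fE; split.
  by apply: ge0_emeasurable_sum.
rewrite integral_nneseries//; apply/esym/esumE.
  by move=> q Qq; apply: integral_ge0 => w _; exact: f0.
by move=> n; rewrite /F; case: ifPn => // _; rewrite integral0.
Qed.

End Sums.

(** * Uniform control of the chi-square statistics *)

(** One random variable controls the chi-square statistics of all the partitions
    generated by two members of the family. *)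
Section Deviations.
Local Open Scope ereal_scope.
Context {R : realType} {dO dX : measure_display} {Omega : measurableType dO}
  {X : measurableType dX}.
Variables (P : probability Omega R) (N : R.-ker Omega ~> X).
Variables (M : set (set (set X))) (Delta : set (set X) -> R) (a Sigma : R).
Hypothesis a0 : (0 < a)%R.
Hypothesis cM : countable M.
Hypothesis fmM : forall m, M m -> finite_measurable_partition m.
Hypothesis dev : forall (xi : R) (m : set (set X)), (0 < xi)%R ->
  finite_measurable_partition m ->
  P [set w | (a * ((psize m)%:R + xi))%:E <= chi2 P N m w] <= (expR (- xi))%:E.
Hypothesis sumDelta : \esum_(m in M) (expR (- Delta m))%:E = Sigma%:E.
Hypothesis Delta1 : forall m, M m -> (1 <= Delta m)%R.

(* With integer levels only, the whole control is a countable sum of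
   probabilities, and the two weights in the level make it converge. *)
Let large (q : set (set X) * set (set X) * nat) : set Omega :=
  [set w | (a * ((psize (pjoin q.1.1 q.1.2))%:R
      + (Delta q.1.1 + Delta q.1.2 + q.2%:R)))%:E
    <= chi2 P N (pjoin q.1.1 q.1.2) w].

Let triples := (M `*` M) `*` [set: nat].

Let measurable_large q : triples q -> measurable (large q).
Proof.
move=> [[M1 M2] _]; rewrite /large -[X in measurable X]setTI.
apply: emeasurable_fun_c_infty => //; apply: measurable_chi2.
by apply: pjoin_partition; exact: fmM.
Qed.

Let Sigma_ge0 : (0 <= Sigma)%R.
Proof.
by rewrite -lee_fin -sumDelta; apply: esum_ge0 => m _; rewrite lee_fin expR_ge0.
Qed.

Let esum_large : \esum_(q in triples) P (large q) <= (2 * Sigma ^+ 2)%:E.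
Proof.
pose p m m' k : R := (expR (- Delta m) * (expR (- Delta m') * expR (- k%:R)))%R.
have p0 m m' k : (0 <= p m m' k)%R by rewrite !mulr_ge0// expR_ge0.
apply: (@le_trans _ _ (\esum_(q in triples) (p q.1.1 q.1.2 q.2)%:E)).
  apply: le_esum => q [[M1 M2] _].
  have D1 := Delta1 M1; have D2 := Delta1 M2.
  have k0 : (0 <= q.2%:R :> R)%R by [].
  apply: (le_trans (dev _ _)).
  - by move: D1 D2 k0; move: (Delta _) (Delta _) (_%:R) => x y k; lra.
  - by apply: pjoin_partition; exact: fmM.
  - by rewrite lee_fin /p !opprD !expRD mulrA.
rewrite -(@esum_esum _ _ _ (M `*` M) (fun=> setT)
  (fun q k => (p q.1 q.2 k)%:E)); last by move=> *; rewrite lee_fin.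
rewrite -(@esum_esum _ _ _ M (fun=> M)
  (fun m m' => \esum_(k in setT) (p m m' k)%:E)); last first.
  by move=> *; apply: esum_ge0 => k _; rewrite lee_fin.
have e0 (x : R) : 0 <= (expR x)%:E by rewrite lee_fin expR_ge0.
apply: (@le_trans _ _ (\esum_(m in M) ((2 * Sigma)%:E * (expR (- Delta m))%:E))).
  apply: le_esum => m Mm.
  apply: (@le_trans _ _ (\esum_(m' in M)
      ((2 * expR (- Delta m))%:E * (expR (- Delta m'))%:E))).
    apply: le_esum => m' _.
    apply: (@le_trans _ _ (\esum_(k in [set: nat])
       ((expR (- Delta m) * expR (- Delta m'))%:E * (expR (- k%:R))%:E))).
      by apply: le_esum => k _; rewrite -EFinM /p mulrA.
    have c0 : (0 <= expR (- Delta m) * expR (- Delta m'))%R.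
      by rewrite mulr_ge0// expR_ge0.
    apply: (le_trans (esumZl_le _ c0 _)) => //.
    apply: (@le_trans _ _ ((expR (- Delta m) * expR (- Delta m'))%:E * 2%:E)).
      by apply: lee_wpmul2l; [rewrite lee_fin|exact: esum_expRN_nat].
    by rewrite -!EFinM lee_fin mulrC mulrA.
  have c0 : (0 <= 2 * expR (- Delta m))%R by rewrite mulr_ge0// expR_ge0.
  apply: (le_trans (esumZl_le _ c0 _)) => //.
  by rewrite sumDelta -!EFinM lee_fin mulrAC.
have c0 : (0 <= 2 * Sigma)%R by rewrite mulr_ge0.
apply: (le_trans (esumZl_le _ c0 _)) => //.
by rewrite sumDelta -EFinM lee_fin -mulrA -expr2.
Qed.

(** [Y w] counts the triples [(m, m', k)] whose event contains [w]. Its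
    expectation is the sum of the probabilities of these events. For given
    [m, m'] the events decrease with [k]; hence if [k] is the integer part of
    [Y w] then the event at level [k] fails, since otherwise the levels
    [0], ..., [k] would all be counted. Thus the integer part of [Y w] is an
    admissible excess. *)
Lemma chi2_uniform_deviation : exists Y : Omega -> \bar R,
  [/\ measurable_fun [set: Omega] Y, forall w, 0 <= Y w,
    \int[P]_w Y w <= (2 * Sigma ^+ 2)%:E &
    forall w, Y w < +oo -> exists xi : R, [/\ (0 <= xi)%R, xi%:E <= Y w &
      forall m m', M m -> M m' -> chi2 P N (pjoin m m') w <
        (a * ((psize (pjoin m m'))%:R + (Delta m + Delta m' + xi)))%:E]].
Proof.
pose Y w := \esum_(q in triples) (\1_(large q) w)%:E : \bar R.
have I0 q w : 0 <= (\1_(large q) w)%:E :> \bar R by rewrite lee_fin.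
have cT : countable triples by apply: countableX => //; exact: countableX.
have mI q : triples q ->
    measurable_fun [set: Omega] (fun w => (\1_(large q) w)%:E : \bar R).
  by move=> Qq; apply/measurable_EFinP/measurable_indic/measurable_large.
have [mY intY] := integral_esum P cT mI (fun q w _ => I0 q w).
exists Y; split=> //; first by move=> w; apply: esum_ge0.
  rewrite intY (le_trans _ esum_large)//; apply: le_esum => q Qq.
  by rewrite integral_indic ?setIT//; exact: measurable_large.
move=> w Yw.
  have Y0 : 0 <= Y w by apply: esum_ge0.
  have Yfin : Y w \is a fin_num by rewrite ge0_fin_numE.
  pose k := Num.truncn (fine (Y w)).
  have /andP[kY Yk] : (k%:R <= fine (Y w) < k.+1%:R)%R.
    by rewrite truncn_itv// fine_ge0.
  exists k%:R; split=> //; first by rewrite -(fineK Yfin) lee_fin.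
  move=> m m' Mm Mm'; rewrite ltNge; apply/negP => big.
  suff : k.+1%:R%:E <= Y w by rewrite -(fineK Yfin) lee_fin leNgt Yk.
  apply: esum_ge; exists ((fun j => (m, m', j)) @` `I_k.+1).
    by split; [exact: finite_image|move=> _ [j _ <-]].
  rewrite fsbig_image; last by move=> i j _ _ [].
  rewrite -fsbig_ord (eq_bigr (fun=> 1%:E)) => [|j _].
    by rewrite sumEFin sumr_const card_ord.
  rewrite indicE mem_set//; apply: le_trans big; rewrite lee_fin.
  rewrite ler_wpM2l ?(ltW a0)// !lerD2l ler_nat; exact: (ltn_ord j).
Qed.

End Deviations.

(** * The risk bound at a sample point *)

Section Histograms.
Local Open Scope ereal_scope.
Context {d : measure_display} {X : measurableType d} {R : realType}.
Variables (mu nu : {measure set X -> \bar R}).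

Lemma cellwise_constant_histogram m : finite_measurable_partition m ->
  cellwise_constant m (histogram mu nu m).
Proof.
move=> [_ _ [_ tm _]] J x y mJ Jx Jy; apply: eq_fsbigr => I /set_mem mI.
congr (_ * _)%R; rewrite !indicE.
suff -> : (x \in I) = (y \in I) by [].
apply/idP/idP => /set_mem.
  by move=> Ix; rewrite (tm I J)// ?inE//; exists x.
by move=> Iy; rewrite (tm I J)// ?inE//; exists y.
Qed.

(** With finite expected masses, an infinite observed mass makes the statistic
    infinite. Hence the observed measure is finite at each sample point where
    the statistic is controlled, and no null set has to be discarded. *)
Lemma chi2_lty (m : set (set X)) (e : set X -> \bar R) :
  finite_set m -> (forall J, m J -> e J \is a fin_num) ->
  \sum_(J \in m) (sqrte (nu J) - sqrte (e J)) ^+ 2 < +oo ->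
  forall J, m J -> nu J < +oo.
Proof.
move=> fm efin chifin J mJ; rewrite ltNge leye_eq; apply/eqP => nuJ.
move: chifin; rewrite ltNge => /negP; apply.
apply: (@le_trans _ _ (\sum_(J \in [set J]) (sqrte (nu J) - sqrte (e J)) ^+ 2)).
  rewrite fsbig_set1 nuJ; have := efin J mJ.
  by case: (e J) => [r _| |]//=; rewrite expe2 mulyy.
apply: lee_fsum_nneg_subset => //.
  by move=> K; rewrite !inE => ->.
by move=> K _; exact: sqre_ge0.
Qed.

Let noise_coefficient_le1 (z : R) :
  (0 < z)%R -> (z < 1 - kappa)%R -> ((kappa * z + 3) / 20 <= 1)%R.
Proof.
by have := @kappa_lt1 R; have := @kappa_gt0 R; move: kappa => k; nra.
Qed.

Let drift_coefficient_le2 (z : R) :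
  (z < 1 - kappa)%R -> (1 + kappa + z <= 2)%R.
Proof. lra. Qed.

Let cells_le (J D n n' M M' e : R) : (J <= D * n + D * n')%R ->
  (J + (M + M' + e) <= D * n + M + (D * n' + M') + e)%R.
Proof. lra. Qed.

Let test_bound (x y h n p p' e : R) : (x <= 2 * h)%R ->
  (n <= p + p' + e)%R -> (x - y + n + p - p' <= 2 * (h + p) - y + e)%R.
Proof. lra. Qed.

(** The risk bound for a fixed sample point, given a bound on all the chi-square
    statistics with excess [xi]. *)
Section Path.
Variables (s : X -> R) (L : Type) (mh : L -> set (set X)).
Variables (Delta : set (set X) -> R) (z delta a xi : R) (lh : L).
Let tau := (20 * a * z ^- 2)%R.
Let sh l := histogram mu nu (mh l).
Let size l : R := (psize (mh l))%:R.
Let pen l := (z * tau * (delta * size l + Delta (mh l)))%R.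
Hypothesis z0 : (0 < z)%R.
Hypothesis z1 : (z < 1 - kappa)%R.
Hypothesis delta1 : (1 <= delta)%R.
Hypothesis a0 : (0 < a)%R.
Hypothesis xi0 : (0 <= xi)%R.
Hypothesis hs : nonneg_integrable mu s.
Hypothesis fm : forall l, finite_measurable_partition (mh l).
Hypothesis hsh : forall l, nonneg_integrable mu (sh l).
Hypothesis Delta1 : forall l, (1 <= Delta (mh l))%R.
Hypothesis join_le : forall l l',
  ((psize (pjoin (mh l) (mh l')))%:R <= delta * Num.max (size l) (size l'))%R.
Hypothesis chi_le : forall l l',
  \sum_(J \in pjoin (mh l) (mh l'))
    (sqrte (nu J) - sqrte (\int[mu]_(x in J) (s x)%:E)) ^+ 2 <=
  (a * ((psize (pjoin (mh l) (mh l')))%:R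
    + (Delta (mh l) + Delta (mh l') + xi)))%:E.
Hypothesis Dlh : forall l, Dcrit mu nu sh pen lh <= Dcrit mu nu sh pen l + tau%:E.

Let tau_gt0 : (0 < tau)%R.
Proof. by rewrite /tau divr_gt0 ?exprn_gt0// mulr_gt0. Qed.

Let size_ge0 l : (0 <= size l)%R. Proof. by []. Qed.

Let pen_ge0 l : (0 <= pen l)%R.
Proof.
have h : (0 <= delta * size l + Delta (mh l))%R.
  rewrite addr_ge0//; last exact: le_trans (Delta1 l).
  by rewrite mulr_ge0// (le_trans _ delta1).
exact: mulr_ge0 (mulr_ge0 (ltW z0) (ltW tau_gt0)) h.
Qed.

(* The penalty is calibrated for this step: [tau = 20 a / z^2] makes the noise
   [(kappa + 3 / z) * chi2] at most the sum of the two penalties, plus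
   [z * tau * xi], because [kappa * z + 3 <= 20]. *)
Let test_le l l' : exists T : R,
  [/\ Tstat mu nu sh pen l l' = T%:E, Tstat mu nu sh pen l' l = (- T)%:E &
    (T <= 2 * (Hsq mu s (sh l) + pen l)
      - (1 - kappa - z) * Hsq mu s (sh l') + z * tau * xi)%R].
Proof.
have fJ := pjoin_partition (fm l) (fm l').
have [finJ mJ _] := fJ; have [_ _ is_] := hs.
have nufin : forall J, pjoin (mh l) (mh l') J -> nu J < +oo.
  apply: (chi2_lty finJ _ (le_lt_trans (chi_le l l') (ltry _))) => J JJ.
  by have mJJ := mJ _ JJ; apply: integrable_fin_num => //; exact: integrableS is_.
have [T [TE TE' Tle]] := Tstat_le hs (hsh l) (hsh l') fJ nufin
  (cellwise_constant_joinl (cellwise_constant_histogram (fm l)))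
  (cellwise_constant_joinr (cellwise_constant_histogram (fm l')))
  pen erefl erefl z0 (chi_le l l').
exists T; split=> //; apply: (le_trans Tle).
set K := ((psize _)%:R + _)%R.
have zt0 : (0 < z * tau)%R by rewrite mulr_gt0.
have Kle : (K <= delta * size l + Delta (mh l)
    + (delta * size l' + Delta (mh l')) + xi)%R.
  have : (delta * Num.max (size l) (size l') <= delta * (size l + size l'))%R.
    rewrite ler_wpM2l ?(le_trans _ delta1)// ge_max.
    by rewrite lerDl lerDr !size_ge0.
  by rewrite mulrDr => /(le_trans (join_le l l'))/cells_le; apply.
have K0 : (0 <= K)%R.
  rewrite addr_ge0// addr_ge0// addr_ge0//.
    exact: le_trans (Delta1 l).
  exact: le_trans (Delta1 l').
have noise : ((kappa + 3 / z) * (a * K) <= z * tau * K)%R.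
  have -> : ((kappa + 3 / z) * (a * K) = (kappa * z + 3) / 20 * (z * tau * K))%R.
    by rewrite /tau; field; rewrite gt_eqF.
  rewrite ler_piMl ?(mulr_ge0 (ltW zt0) K0)//.
  exact: noise_coefficient_le1.
apply: test_bound.
  by rewrite ler_wpM2r ?Hsq_ge0//; exact: drift_coefficient_le2.
apply: (le_trans noise).
rewrite (_ : pen l + pen l' + z * tau * xi = z * tau * (delta * size l
    + Delta (mh l) + (delta * size l' + Delta (mh l')) + xi))%R.
  by rewrite ler_wpM2l// ltW.
by rewrite /pen !mulrDr.
Qed.

Lemma pathwise_risk_le l :
  (Hsq mu s (sh lh) <= 14 * (delta + 2) / (1 - kappa - z) *
    (Hsq mu s (sh l) + tau * Num.max (size l) (Delta (mh l)) + tau * xi))%R.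
Proof.
have b01 : (0 < 1 - kappa - z <= 1)%R by have := @kappa_gt0 R; move: z0 z1; lra.
have e0 := mulr_ge0 (mulr_ge0 (ltW z0) (ltW tau_gt0)) xi0.
have := selection_risk_le hs hsh b01 e0 (ltW tau_gt0) pen_ge0 test_le (Dlh l).
have [b0 _] := andP b01; move=> /le_trans; apply.
set mx := Num.max _ _.
have sm : (size l <= mx)%R by rewrite le_max lexx.
have Dm : (Delta (mh l) <= mx)%R by rewrite le_max lexx orbT.
have pen_le : (pen l <= tau * (delta * mx + mx))%R.
  have h : (delta * size l + Delta (mh l) <= delta * mx + mx)%R.
    by rewrite lerD// ler_wpM2l// (le_trans _ delta1).
  have z1' : (z <= 1)%R by have := @kappa_gt0 R; move: z1; lra.
  have mx0 : (0 <= delta * mx + mx)%R.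
    have mx0 := le_trans (size_ge0 l) sm.
    by rewrite addr_ge0// mulr_ge0// (le_trans _ delta1).
  apply: (@le_trans _ _ (z * tau * (delta * mx + mx))%R).
    by rewrite /pen ler_wpM2l// mulr_ge0// ltW.
  by rewrite -mulrA ler_piMl// mulr_ge0// ltW.
have zx : (z * tau * xi <= tau * xi)%R.
  rewrite -mulrA ler_piMl ?(mulr_ge0 (ltW tau_gt0) xi0)//.
  by have := @kappa_gt0 R; move: z1; lra.
have tm : (tau <= tau * mx)%R.
  by rewrite ler_peMr ?(ltW tau_gt0)// (le_trans (Delta1 l)).
rewrite [leRHS](_ : _ = 14 / (1 - kappa - z) * ((delta + 2) *
    (Hsq mu s (sh l) + tau * mx + tau * xi)))%R; last first.
  by field; rewrite gt_eqF.
rewrite ler_wpM2l ?divr_ge0 ?(ltW b0)//.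
have h0 := Hsq_ge0 mu s (sh l).
have := mulr_ge0 (le_trans ler01 delta1) h0.
have := mulr_ge0 (le_trans ler01 delta1) (mulr_ge0 (ltW tau_gt0) xi0).
have := mulr_ge0 (ltW tau_gt0) xi0.
by move: pen_le zx tm h0; lra.
Qed.

End Path.
End Histograms.

(** * The risk of the selected estimator *)

Theorem corollary5 (R : realType) (z delta Sigma : R) :
  0 < z -> z < 1 - (Num.sqrt 2)^-1 -> 1 <= delta ->
  exists2 C : R, 0 < C &
  forall (dO : measure_display) (Omega : measurableType dO)
    (P : probability Omega R)
    (dX : measure_display) (X : measurableType dX)
    (mu : {measure set X -> \bar R})
    (N : R.-ker Omega ~> X) (s : X -> R) (L0 : set (X -> R))
    (M : set (set (set X))) (Delta : set (set X) -> R)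
    (L : Type) (mhat : L -> Omega -> set (set X)) (lhat : Omega -> L) (a : R),
  let tau := 20 * a * z ^- 2 in
  let shat (w : Omega) (l : L) : X -> R := histogram mu (N w) (mhat l w) in
  let pen (w : Omega) (l : L) : R :=
    z * tau * (delta * (psize (mhat l w))%:R + Delta (mhat l w)) in
  (* the random measure, its intensity, and the set of densities *)
  has_intensity P N mu s ->
  L0 `<=` nonneg_integrable mu ->
  L0 s ->
  (* the families of partitions and of indices *)
  countable M ->
  (forall m, M m -> finite_measurable_partition m) ->
  (forall m w, M m -> histogram_model L0 m (histogram mu (N w) m)) ->
  countable [set: L] ->
  (* the assumptions on N and on the family of partitions *)
  0 < a ->
  (forall (xi : R) (m : set (set X)), 0 < xi -> finite_measurable_partition m ->
    (P [set w | (a * ((psize m)%:R + xi))%:E <= chi2 P N m w]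
       <= (expR (- xi))%:E)%E) ->
  (forall m m', M m -> M m' ->
    (psize (pjoin m m'))%:R
      <= delta * Num.max (psize m)%:R (psize m')%:R) ->
  (\esum_(m in M) (expR (- Delta m))%:E = Sigma%:E)%E ->
  (forall m, M m -> 1 <= Delta m) ->
  (* the model selection strategies, based on N *)
  (forall l w, M (mhat l w)) ->
  (forall l m, M m -> sigma_of_N N [set w | mhat l w = m]) ->
  (* the selected index *)
  (forall l, measurable [set w | lhat w = l]) ->
  (forall w l, (Dcrit mu (N w) (shat w) (pen w) (lhat w)
                  <= Dcrit mu (N w) (shat w) (pen w) l + tau%:E)%E) ->
  (C%:E * \int[P]_w hellinger2 mu s (shat w (lhat w))
     <= ereal_inf [set \int[P]_w (hellinger2 mu s (shat w l)
          + (tau * Num.max (psize (mhat l w))%:R (Delta (mhat l w)))%:E)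
        | l in [set: L]])%E.
Proof.
move=> z0 z1 delta1; have b0 : 0 < 1 - kappa - z by rewrite subr_gt0.
pose c : R := 14 * (delta + 2) / (1 - kappa - z).
have c0 : 0 < c by rewrite divr_gt0// mulr_gt0//; lra.
have S0 : 0 < 1 + 2 * Sigma ^+ 2.
  by rewrite ltr_pwDl// mulr_ge0// sqr_ge0.
exists (c * (1 + 2 * Sigma ^+ 2))^-1; first by rewrite invr_gt0 mulr_gt0.
move=> dO Omega P dX X mu N s L0 M Delta L mhat lhat a tau shat pen.
move=> intensity L0sub L0s cM fmM histM _ a0 dev join_le sumDelta Delta1.
move=> mhatM _ _ Dlhat; apply/ereal_infP => _ [l _ <-].
have hs := L0sub _ L0s.
have hsh w k : nonneg_integrable mu (shat w k).
  by apply: L0sub; have [] := histM (mhat k w) w (mhatM k w).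
have tau0 : 0 < tau by rewrite /tau divr_gt0 ?exprn_gt0// mulr_gt0.
have [Y [mY Y0 intY dY]] := chi2_uniform_deviation a0 cM fmM dev sumDelta Delta1.
set G := fun w => (hellinger2 mu s (shat w l) +
  (tau * Num.max (psize (mhat l w))%:R (Delta (mhat l w)))%:E)%E.
(* The bound is at least [tau], because the weights are at least [1]; this
   absorbs the terms in [tau] at the end. *)
have tauG w : (tau%:E <= G w)%E.
  rewrite /G hellinger2_fin// -EFinD lee_fin -[leLHS]add0r lerD ?Hsq_ge0//.
  by rewrite ler_peMr ?(ltW tau0)// le_max Delta1 ?orbT.
have G0 w : (0 <= G w)%E by rewrite (le_trans _ (tauG w))// lee_fin ltW.
have tY0 w : (0 <= tau%:E * Y w)%E by rewrite mule_ge0// lee_fin ltW.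
have path w : (c^-1%:E * hellinger2 mu s (shat w (lhat w)) <=
    G w + tau%:E * Y w)%E.
  have := Y0 w; case: (ltP (Y w) +oo%E) => [Yfin _|]; last first.
    rewrite leye_eq => /eqP -> _.
    by rewrite gt0_muley ?lte_fin// addey ?leey// gt_eqF// (lt_le_trans _ (G0 w)).
  have [xi [xi0 xiY chi_lt]] := dY w Yfin.
  have chi_le k k' : (\sum_(J \in pjoin (mhat k w) (mhat k' w))
     (sqrte (N w J) - sqrte (\int[mu]_(x in J) (s x)%:E)) ^+ 2 <=
     (a * ((psize (pjoin (mhat k w) (mhat k' w)))%:R
       + (Delta (mhat k w) + Delta (mhat k' w) + xi)))%:E)%E.
    apply: le_trans (ltW (chi_lt _ _ (mhatM k w) (mhatM k' w))).
    rewrite le_eqVlt; apply/orP; left; apply/eqP; apply: eq_fsbigr => J.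
    move=> /set_mem JJ; have [_ mJ _] := pjoin_partition
      (fmM _ (mhatM k w)) (fmM _ (mhatM k' w)).
    by have [-> _] := intensity J (mJ _ JJ).
  have := @pathwise_risk_le _ _ _ mu (N w) s L (mhat^~ w) Delta z delta a xi
    (lhat w) z0 z1 delta1 a0 xi0 hs (fun k => fmM _ (mhatM k w)) (hsh w)
    (fun k => Delta1 _ (mhatM k w))
    (fun k k' => join_le _ _ (mhatM k w) (mhatM k' w)) chi_le (Dlhat w) l.
  rewrite -/c -ler_pdivrMl// => risk.
  rewrite hellinger2_fin// /G hellinger2_fin// -EFinM.
  apply: (@le_trans _ _ (Hsq mu s (shat w l) + tau *
      Num.max (psize (mhat l w))%:R (Delta (mhat l w)) + tau * xi)%:E).
    by rewrite lee_fin.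
  by rewrite EFinD leeD// EFinM lee_pmul2l// lte_fin.
have mtY : measurable_fun [set: Omega] (fun w => (tau%:E * Y w)%E).
  exact: emeasurable_funM.
have c0' : 0 < c^-1 by rewrite invr_gt0.
have h0 w : (0 <= hellinger2 mu s (shat w (lhat w)))%E.
  by rewrite hellinger2_fin// lee_fin Hsq_ge0.
have main := le_integral_measurableD P c0' h0 G0 tY0 mtY path.
have tau_int : (tau%:E <= \int[P]_w G w)%E.
  rewrite -[leLHS]mule1 -(@probability_setT _ _ _ P) -integral_cst//.
  by apply: le_nn_integral => // w; rewrite lee_fin ltW.
have total : (\int[P]_w G w + \int[P]_w (tau%:E * Y w) <=
    (1 + 2 * Sigma ^+ 2)%:E * \int[P]_w G w)%E.
  have S0' : 0 <= 2 * Sigma ^+ 2 by rewrite mulr_ge0// sqr_ge0.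
  rewrite EFinD ge0_muleDl ?lee_fin// mul1e leeD2l//.
  rewrite ge0_integralZl// ?lee_fin ?(ltW tau0)//.
  apply: (@le_trans _ _ (tau%:E * (2 * Sigma ^+ 2)%:E)%E).
    by apply: lee_wpmul2l => //; rewrite lee_fin ltW.
  by rewrite muleC; apply: lee_wpmul2l; rewrite ?lee_fin.
rewrite invfM mulrC EFinM -muleA lee_pdivrMl//.
exact: le_trans main total.
Qed.
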